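(* Assume that the shot ensembles are independent across all components $(P,\tau)$, and that each component is estimated with $N$ independent shots. Let $\delta\in(0,1)$. Then, with probability at least $1-\delta$, $$|\widehat E_g-E_g|\le 2\|c\|_2\sqrt{\frac{\log(2/\delta)}{N}},\qquad \|c\|_2^2=\sum_{P\in\mathcal P}c_P^2 .$$
   Context: Let $H=\sum_{P\in\mathcal P}c_P P$ be an $n$-qubit Hamiltonian written as a finite real linear combination of Pauli strings, $|\psi\rangle$ a normalized state, $g:\{0,1\}^n\to\mathbb R$ a fixed function, $U_g=\sum_s e^{ig(s)}|s\rangle\langle s|$, and $E_g=\langle\psi|U_g^\dagger HU_g|\psi\rangle$ the exact U-VQNHE (unitary variational quantum-neural hybrid eigensolver) energy. For each $P$, the expectation value $\langle\psi|U_g^\dagger PU_g|\psi\rangle$ is estimated from one or two real-valued circuit components (for real and imaginary parts), indexed by $\tau\in T_P\subseteq\{R,I\}$ (so $|T_P|\le 2$): for each component there are a probability distribution $\pi_{P,\tau}$ of measurement outcomes $s$ and a real function $X_{P,\tau}$ with $|X_{P,\tau}(s)|\le 1$, with $$\mu_{P,\tau}=\mathbb E_{s\sim\pi_{P,\tau}}[X_{P,\tau}(s)],\qquad E_g=\sum_{P\in\mathcal P}c_P\sum_{\tau\in T_P}\mu_{P,\tau}.$$ Given, for each component $(P,\tau)$, $N\ge1$ independent shots $s_1,\dots,s_N\sim\pi_{P,\tau}$, define $$\widehat\mu_{P,\tau}=\frac1N\sum_{k=1}^N X_{P,\tau}(s_k),\qquad \widehat E_g=\sum_{P\in\mathcal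 P}c_P\sum_{\tau\in T_P}\widehat\mu_{P,\tau}.$$ $\log$ is the natural logarithm. *)

(* Defs.v *)
From HB Require Import structures.
From mathcomp Require Import all_boot all_order all_algebra.
From mathcomp Require Import all_classical all_reals all_analysis.
From mathcomp Require Import complex.

Set Implicit Arguments.
Unset Strict Implicit.
Unset Printing Implicit Defensive.

Import Order.TTheory GRing.Theory Num.Theory.

Local Open Scope classical_set_scope.
Local Open Scope complex_scope.
Local Open Scope ring_scope.
Local Open Scope sesquilinear_scope.

Inductive pauli := PauliI | PauliX | PauliY | PauliZ.

Definition ord_of_pauli (p : pauli) : 'I_4 :=
  match p with
  | PauliI => inord 0 | PauliX => inord 1 | PauliY => inord 2 | PauliZ => inord 3
  end.

Definition pauli_of_ord (i : 'I_4) : pauli :=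
  nth PauliI [:: PauliI; PauliX; PauliY; PauliZ] i.

Lemma ord_of_pauliK : cancel ord_of_pauli pauli_of_ord.
Proof. by case; rewrite /pauli_of_ord /= inordK. Qed.

HB.instance Definition _ := Finite.copy pauli (can_type ord_of_pauliK).

(** [RePart] and [ImPart] are the labels R and I of the circuit components. *)
Inductive part := RePart | ImPart.

Definition bool_of_part (t : part) : bool := if t is RePart then true else false.
Definition part_of_bool (b : bool) : part := if b then RePart else ImPart.

Lemma bool_of_partK : cancel bool_of_part part_of_bool.
Proof. by case. Qed.

HB.instance Definition _ := Finite.copy part (can_type bool_of_partK).

Section qubits.
Variables (R : realType) (n : nat).

Definition bitstring := {ffun 'I_n -> bool}.
Definition pauli_string := {ffun 'I_n -> pauli}.

Notation dim := #|{: bitstring}|.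

(** Operators are matrices in the computational basis, whose [i]-th vector is
    the basis state [bits i]. *)
Definition bits (i : 'I_dim) : bitstring := enum_val i.

(** [pauli_coef p a b] is <a|p|b>, with [false] for |0> and [true] for |1>. *)
Definition pauli_coef (p : pauli) (a b : bool) : R[i] :=
  match p with
  | PauliI => (a == b)%:R
  | PauliX => (a != b)%:R
  | PauliY => if a == b then 0 else if a then 0 +i* 1 else 0 -i* 1
  | PauliZ => if a == b then (-1) ^+ a else 0
  end.

Definition pauli_mx (P : pauli_string) : 'M[R[i]]_dim :=
  \matrix_(i, j) \prod_(q < n) pauli_coef (P q) (bits i q) (bits j q).

Definition hamiltonian (PP : {set pauli_string}) (c : pauli_string -> R) :
    'M[R[i]]_dim :=
  \sum_(P in PP) (c P)%:C *: pauli_mx P.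

Definition phase_mx (g : bitstring -> R) : 'M[R[i]]_dim :=
  diag_mx (\row_i (cos (g (bits i)) +i* sin (g (bits i)))).

Definition normalized (psi : 'cV[R[i]]_dim) : Prop := psi^t* *m psi = 1%:M.

Definition braket (psi : 'cV[R[i]]_dim) (A : 'M[R[i]]_dim) : R[i] :=
  (psi^t* *m A *m psi) ord0 ord0.

(** Taking the real part loses nothing, see [energyE]. *)
Definition energy (PP : {set pauli_string}) (c : pauli_string -> R)
    (psi : 'cV[R[i]]_dim) (g : bitstring -> R) : R :=
  complex.Re (braket psi ((phase_mx g)^t* *m hamiltonian PP c *m phase_mx g)).

Lemma hamiltonian_herm PP c : (hamiltonian PP c)^t* = hamiltonian PP c.
Proof.
apply/matrixP => i j; rewrite !mxE !summxE rmorph_sum; apply: eq_bigr => P _ /=.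
rewrite !mxE rmorphM rmorph_prod; congr (_ * _).
  by apply/eqP; rewrite eq_complex /= oppr0 !eqxx.
apply: eq_bigr => q _ /=; rewrite /pauli_coef.
by case: (P q); case: (bits i q); case: (bits j q);
  apply/eqP; rewrite eq_complex /= ?oppr0 ?opprK ?eqxx.
Qed.

Lemma energyE PP c psi g : (energy PP c psi g)%:C =
  braket psi ((phase_mx g)^t* *m hamiltonian PP c *m phase_mx g).
Proof.
rewrite /energy; set A := _ *m phase_mx g.
have AA : A^t* = A.
  by rewrite /A !trmx_mul !map_mxM trmxCK hamiltonian_herm mulmxA.
clearbody A; have BB : (psi^t* *m A *m psi)^t* = psi^t* *m A *m psi.
  by rewrite !trmx_mul !map_mxM trmxCK AA mulmxA.
have : (braket psi A)^* = braket psi A by rewrite /braket -[in RHS]BB !mxE.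
by case: (braket psi A) => a b [] /eqP; rewrite eqNr => /eqP ->.
Qed.

End qubits.

(** Mutual independence of the random elements [Y i], [i] in [D]. *)
Definition mutually_independent (R : realType) (d : measure_display)
    (Omega : measurableType d) (Pr : probability Omega R)
    (I : finType) (D : {set I}) (dT : I -> measure_display)
    (T : forall i, measurableType (dT i)) (Y : forall i, Omega -> T i) : Prop :=
  forall (J : {set I}) (A : forall i, set (T i)), J \subset D ->
    (forall i, i \in J -> measurable (A i)) ->
    Pr (\bigcap_(i in [set` J]) (Y i @^-1` A i)) =
    (\prod_(i in J) Pr (Y i @^-1` A i))%E.

Definition sample_mean (R : realType) (N : nat) (O : Type) (X : O -> R)
    (s : 'I_N -> O) : R :=
  N%:R^-1 * \sum_(k < N) X (s k).

(* Main.v *)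
(** For [|m| <= 1] the two-point law on {-1, 1} with mean [m] is, once centered,
    subgaussian with variance proxy 1; by convexity of the exponential, so is
    [X - E X] for every random variable with [|X| <= 1] (Hoeffding's lemma). The
    error of the energy estimator is a sum of independent centered variables
    [c P / N * (X P t (shot P t k) - mu P t)], hence subgaussian with variance
    proxy [\sum_P #|T P| * c P ^ 2 / N <= 2 * ||c||^2 / N], and Chernoff's bound
    applied to both tails yields the stated radius. *)
Require Import Defs.
From mathcomp Require Import all_boot all_order all_algebra.
From mathcomp Require Import all_classical all_reals all_analysis.
From mathcomp Require Import measurable_realfun complex ring lra.
Import Order.TTheory GRing.Theory Num.Theory.
Local Open Scope classical_set_scope.
Local Open Scope complex_scope.
Local Open Scope ring_scope.

Set Implicit Arguments.
Unset Strict Implicit.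
Unset Printing Implicit Defensive.

(** * Moment generating function of a centered two-point law *)

(* [tanh x <= x], cleared of denominators. *)
Lemma expR_tanh_le (R : realType) (x : R) :
  0 <= x -> expR (2 * x) * (1 - x) <= 1 + x.
Proof.
move=> x0; pose K (y : R) := expR (2 * y) * (1 - y) - y.
have dK (y : R) : is_derive y 1 K (expR (2 * y) * (1 - 2 * y) - 1).
  apply: is_derive_eq.
  by rewrite /GRing.scale /=; ring.
suff : K x <= K 0 by rewrite /K mulr0 expR0; lra.
apply: (@ler0_derive1_nincry _ K 0) => //.
(* [K] is nonincreasing because [1 - 2 * y <= expR (- (2 * y))], and [K 0 = 1]. *)
- move=> y _; rewrite derive1E derive_val subr_le0.
  rewrite -[leRHS](@expR0 R) -[in leRHS](subrr (2 * y)) expRD.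
  by rewrite ler_pM2l ?expR_gt0//; exact: expR_ge1Dx.
- by apply: derivable_within_continuous => y _; have [] := dK y.
Qed.

(** The quotient [G] of the moment generating function by [expR (y ^+ 2 / 2)] equals 1 at 0 and is
    nonincreasing for [y >= 0]. With [z = expR y], the sign of its derivative is that of a quadratic
    polynomial in [m], treated separately for [y <= 2] and [y > 2]. *)
Lemma two_point_mgf_le_nneg (R : realType) (m l : R) : `|m| <= 1 -> 0 <= l ->
  (1 + m) / 2 * expR (l * (1 - m)) + (1 - m) / 2 * expR (- (l * (1 + m)))
  <= expR (l ^+ 2 / 2).
Proof.
rewrite ler_norml => /andP[m1 m2] l0.
pose F (y : R) :=
  (1 + m) / 2 * expR (y * (1 - m)) + (1 - m) / 2 * expR (- (y * (1 + m))).
pose G (y : R) := F y * expR (- (y ^+ 2 / 2)).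
have dG (y : R) : is_derive y 1 G
  (((1 - m ^+ 2) / 2 * (expR (y * (1 - m)) - expR (- (y * (1 + m)))) - y * F y)
   * expR (- (y ^+ 2 / 2))).
  apply: is_derive_eq.
  by rewrite /F /GRing.scale /= ?expr1; field.
have G0 : G 0 = 1 by rewrite /G /F expr0n /= !mul0r !oppr0 expR0; field.
have FG : F l = G l * expR (l ^+ 2 / 2).
  by rewrite /G -mulrA -expRD addNr expR0 mulr1.
rewrite -/(F l) FG -[leRHS]mul1r ler_wpM2r ?expR_ge0// -G0.
apply: (@ler0_derive1_nincry _ G 0) => //.
- move=> y; rewrite in_itv /= andbT => y0.
  rewrite derive1E derive_val mulr_le0_ge0 ?expR_ge0// /F.
  have [z zE] : exists z, z = expR y by exists (expR y).
  have -> : expR (y * (1 - m)) = z ^+ 2 * expR (- (y * (1 + m))).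
    by rewrite zE -expRM_natl -expRD; congr expR; ring.
  set e := expR (- _); have e0 : 0 < e by exact: expR_gt0.
  suff H : (1 - m ^+ 2) * (z ^+ 2 - 1) - y * ((1 + m) * z ^+ 2 + (1 - m)) <= 0.
    rewrite (_ : _ - _ = e / 2 * ((1 - m ^+ 2) * (z ^+ 2 - 1)
      - y * ((1 + m) * z ^+ 2 + (1 - m)))); last by field.
    by rewrite mulr_ge0_le0// divr_ge0// ltW.
  have z1 : 1 <= z by rewrite zE; apply: le_trans (expR_ge1Dx y); lra.
  have z21 : 0 <= z ^+ 2 - 1 by rewrite subr_ge0 exprn_ege1.
  pose x := y / 2; have yE : y = 2 * x by rewrite /x; field.
  have x0 : 0 < x by rewrite divr_gt0.
  have [x1|x1] := leP x 1.
    have zx : z * (1 - x) <= 1 + x by rewrite zE yE; exact/expR_tanh_le/ltW.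
    have zx2 : (z * (1 - x)) ^+ 2 <= (1 + x) ^+ 2.
      by rewrite ler_pXn2r// nnegrE; [rewrite mulr_ge0//; lra|lra].
    (* As a function of [m], the left-hand side is maximal at [- x]. *)
    have mx : 0 <= (z ^+ 2 - 1) * (m + x) ^+ 2 by rewrite mulr_ge0// sqr_ge0.
    by rewrite yE; lra.
  (* For [y > 2] the expression equals [- (z ^+ 2 - 1) * (1 + m) * (y + m - 1) - 2 * y], and
     [y + m - 1 >= 0] since [m >= -1]. *)
  have : 0 <= (z ^+ 2 - 1) * ((1 + m) * (y + m - 1)).
    by rewrite mulr_ge0// mulr_ge0//; lra.
  by lra.
- by apply: derivable_within_continuous => y _; have [] := dG y.
Qed.

Lemma two_point_mgf_le (R : realType) (m l : R) : `|m| <= 1 ->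
  (1 + m) / 2 * expR (l * (1 - m)) + (1 - m) / 2 * expR (- (l * (1 + m)))
  <= expR (l ^+ 2 / 2).
Proof.
move=> m1; have [l0|l0] := leP 0 l; first exact: two_point_mgf_le_nneg.
(* Negating both [m] and [l] exchanges the two atoms. *)
have := @two_point_mgf_le_nneg _ (- m) (- l).
rewrite normrN sqrrN => /(_ m1); rewrite oppr_ge0 (ltW l0) => /(_ isT).
by rewrite addrC !opprK !mulNr opprK.
Qed.

(** * Expectation of a product of independent nonnegative factors *)

Section independence.
Local Open Scope ereal_scope.
Import HBNNSimple.

(** Standard extension from indicators: linearity gives simple functions, monotone convergence gives
    nonnegative measurable functions. In the application [W] is the product of the other factors and
    [C] the product of their expectations. *)
Lemma ge0_integral_comp_indic_ext (R : realType) (d d' : measure_display)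
    (Omega : measurableType d) (T : measurableType d')
    (mu : {measure set Omega -> \bar R}) (y : Omega -> T) (W : Omega -> R)
    (C : R) :
  measurable_fun setT y -> measurable_fun setT W ->
  (forall w, 0 <= W w)%R -> (0 <= C)%R ->
  (forall A, measurable A ->
    \int[mu]_w (W w * \1_A (y w))%:E = C%:E * mu (y @^-1` A)) ->
  forall f : T -> R, measurable_fun setT f -> (forall x, 0 <= f x)%R ->
    \int[mu]_w (W w * f (y w))%:E = C%:E * \int[mu]_w (f (y w))%:E.
Proof.
move=> my mW W0 C0 H f mf f0.
have mypre A : measurable A -> measurable (y @^-1` A).
  by move=> mA; rewrite -[_ @^-1` _]setTI; exact: my.
have simple (h : {nnsfun T >-> R}) :
    \int[mu]_w (W w * h (y w))%:E = C%:E * \int[mu]_w (h (y w))%:E.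
  pose A r := h @^-1` [set r].
  have mA r : measurable (A r) by exact: measurable_sfunP.
  have mI r : measurable_fun setT (fun w => \1_(A r) (y w) : R).
    by apply: measurableT_comp => //; exact: measurable_indic.
  (* Absolute values make every term nonnegative whatever [r] is, as splitting the integral of the
     sum requires; they change nothing, since the values of [h] are nonnegative. *)
  have [s hE] : exists s : seq R, forall x,
      h x = (\sum_(r <- s) `|r| * \1_(A r) x)%R.
    exists (finmap.enum_fset (fset_set (range h))) => x.
    rewrite fimfunE fsbig_finite//=.
    apply: eq_bigr => r _; rewrite indicE.
    case: (boolP (x \in _)) => [|_]; last by rewrite !mulr0.
    by rewrite inE /= => <-; rewrite ger0_norm.
  under eq_integral do rewrite hE mulr_sumr -sumEFin.
  under [in RHS]eq_integral do rewrite hE -sumEFin.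
  rewrite !ge0_integral_sum//; last 3 first.
  - by move=> r; apply/measurable_EFinP; exact: measurable_funM.
  - move=> r; apply/measurable_EFinP; apply: measurable_funM => //.
    exact: measurable_funM.
  - by move=> r w _; rewrite lee_fin !mulr_ge0.
  rewrite ge0_sume_distrr; last first.
    by move=> r _; apply: integral_ge0 => w _; rewrite lee_fin mulr_ge0.
  apply: eq_bigr => r _.
  under eq_integral do rewrite mulrCA EFinM.
  under [in RHS]eq_integral do rewrite EFinM.
  rewrite !ge0_integralZl_EFin//; last 3 first.
  - exact/measurable_EFinP.
  - by move=> w _; rewrite lee_fin mulr_ge0.
  - by apply/measurable_EFinP; exact: measurable_funM.
  rewrite H// muleCA; congr (_ * (_ * _)).
  rewrite (_ : (fun w => _) = (fun w => (\1_(y @^-1` A r) w)%:E)).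
    by rewrite integral_indic ?setIT//; exact: mypre.
  by apply/funext => w; rewrite !indicE.
(* Both sides pass to the limit along a nondecreasing sequence of simple functions converging to
   [f]. *)
pose h := nnsfun_approx measurableT ((measurable_EFinP setT f).2 mf).
have cvgh x : (h n x)%:E @[n --> \oo] --> (f x)%:E.
  by apply: cvg_nnsfun_approx => // t _; rewrite lee_fin.
have ndh x m n : (m <= n)%N -> (h m x <= h n x)%R.
  by move=> mn; exact/lefP/nd_nnsfun_approx.
have mh n : measurable_fun setT (fun w => h n (y w)) by exact: measurableT_comp.
have L1 : \int[mu]_w (W w * h n (y w))%:E @[n --> \oo] -->
    \int[mu]_w (W w * f (y w))%:E.
  have := @cvg_monotone_convergence _ _ _ mu setT measurableT
    (fun n w => (W w * h n (y w))%:E).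
  rewrite (_ : (fun x => limn _) = (fun w => (W w * f (y w))%:E)).
    apply.
    - by move=> n; apply/measurable_EFinP; exact: measurable_funM.
    - by move=> n w _; rewrite lee_fin mulr_ge0.
    - by move=> w _ m n mn; rewrite lee_fin ler_wpM2l// ndh.
  apply/funext => w; apply/cvg_lim => //.
  by under eq_fun do rewrite EFinM; rewrite EFinM; apply: cvgeZl.
have L2 : \int[mu]_w (h n (y w))%:E @[n --> \oo] --> \int[mu]_w (f (y w))%:E.
  have := @cvg_monotone_convergence _ _ _ mu setT measurableT
    (fun n w => (h n (y w))%:E).
  rewrite (_ : (fun x => limn _) = (fun w => (f (y w))%:E)).
    apply.
    - by move=> n; exact/measurable_EFinP.
    - by move=> n w _; rewrite lee_fin.
    - by move=> w _ m n mn; rewrite lee_fin ndh.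
  by apply/funext => w; apply/cvg_lim.
have L3 : \int[mu]_w (W w * h n (y w))%:E @[n --> \oo] -->
    C%:E * \int[mu]_w (f (y w))%:E.
  by under eq_fun do rewrite simple; exact: cvgeZl.
exact: cvg_unique L1 L3.
Qed.

(* The factors are replaced by indicators one at a time: if the formula holds
   whenever [f j] is an indicator, then it extends to all [f j >= 0] by
   [ge0_integral_comp_indic_ext]. In the induction, [S] indexes the factors that
   may be arbitrary; the others are indicators. *)
Lemma integral_prod_indep (R : realType) (d : measure_display)
    (Omega : measurableType d) (Pr : probability Omega R)
    (I : finType) (D : {set I}) (dT : I -> measure_display)
    (T : forall i, measurableType (dT i)) (Y : forall i, Omega -> T i)
    (f : forall i, T i -> R) :
  (forall i, measurable_fun setT (Y i)) ->
  (forall i, measurable_fun setT (f i)) ->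
  (forall i x, 0 <= f i x)%R ->
  (forall i, i \in D -> \int[Pr]_w (f i (Y i w))%:E < +oo) ->
  mutually_independent Pr D Y ->
  \int[Pr]_w (\prod_(i in D) f i (Y i w))%:E =
  \prod_(i in D) \int[Pr]_w (f i (Y i w))%:E.
Proof.
move=> mY mf f0 fy indep.
have mYpre i A : measurable A -> measurable (Y i @^-1` A).
  by move=> mA; rewrite -[_ @^-1` _]setTI; exact: mY.
have [S] : exists S : {set I}, S \subset D /\
    (forall i, i \in D :\: S -> exists2 A, measurable A & f i = \1_A).
  by exists D; split => // i; rewrite finset.setDv inE.
elim: {S}_.+1 {-2}S (ltnSn #|S|) f mf f0 fy => // k IH S Sk f mf f0 fy [SD fS].
have [S0|[j jS]] := set_0Vmem S.
  (* When [S] is empty the product is the indicator of an intersection of preimages, so the formula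
     is the definition of independence with [J = D]. The default [setT] outside [D] allows a set to
     be chosen for every [i]. *)
  have {}fS i : exists A : set (T i), i \in D -> measurable A /\ f i = \1_A.
    have [iD|iD] := boolP (i \in D); last by exists setT.
    by have [|A mA fA] := fS i; [rewrite S0 finset.setD0|exists A].
  pose A i := projT1 (cid (fS i)).
  have mA i : i \in D -> measurable (A i).
    by move=> iD; rewrite /A; case: cid => B /= /(_ iD)[].
  have fA i : i \in D -> f i = \1_(A i).
    by move=> iD; rewrite /A; case: cid => B /= /(_ iD)[].
  transitivity (Pr (\bigcap_(i in [set` D]) (Y i @^-1` A i))).
    rewrite -[X in _ = Pr X]setIT -integral_indic//; last first.
      by apply: fin_bigcap_measurable => // i /= iD; exact/mYpre/mA.
    apply: eq_integral => w _; congr EFin.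
    rewrite indicE; case: (boolP (w \in _)) => [|].
      rewrite inE => H; apply: big1 => i iD.
      by rewrite fA// indicE mem_set//; exact: H.
    move=> H; have [i iD iA] : exists2 i, i \in D & ~ A i (Y i w).
      apply: contrapT => K; move/negP: H; apply; rewrite inE => i iD.
      by apply: contrapT => iA; apply: K; exists i.
    by rewrite (bigD1 i)//= fA// indicE memNset// mul0r.
  rewrite indep//; apply: eq_bigr => i iD.
  rewrite -[RHS](_ : \int[Pr]_w (\1_(Y i @^-1` A i) w)%:E = _).
    by rewrite integral_indic ?setIT//; exact/mYpre/mA.
  by apply: eq_integral => w _; rewrite fA// !indicE.
have jD : j \in D by exact: (fintype.subsetP SD).
pose W w := (\prod_(i in D | i != j) f i (Y i w))%R.
(* Every factor is finite by [fy], so [fine] loses nothing. *)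
pose C := fine (\prod_(i in D | i != j) \int[Pr]_w (f i (Y i w))%:E).
have CE : C%:E = \prod_(i in D | i != j) \int[Pr]_w (f i (Y i w))%:E.
  rewrite fineK//; apply: prode_fin_num => i /andP[iD _].
  rewrite ge0_fin_numE ?fy//.
  by apply: integral_ge0 => w _; rewrite lee_fin.
under eq_integral => w _ do rewrite (bigD1 j)//= mulrC -/(W w).
rewrite (bigD1 j)//= muleC -CE.
apply: ge0_integral_comp_indic_ext => //.
- rewrite (_ : W = fun w => \prod_(i <- enum [pred i in D | i != j])
      f i (Y i w))%R.
    by apply: measurable_prod => i _; exact: measurableT_comp.
  by apply/funext => w; rewrite big_enum.
- by move=> w; rewrite /W; apply: prodr_ge0.
- rewrite /C fine_ge0//; apply: prode_ge0 => i _.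
  by apply: integral_ge0 => w _; rewrite lee_fin.
move=> A mA.
(* [f'] has an indicator in place of [f j], so the induction hypothesis for [S :\ j] yields the
   formula that the extension lemma asks for. *)
pose f' : forall i, T i -> R := eqtype.dfwith f (\1_A : T j -> R).
have f'j : f' j = \1_A by rewrite /f' eqtype.dfwith_in.
have f'E i : i != j -> f' i = f i.
  by move=> ij; rewrite /f' eqtype.dfwith_out// eq_sym.
have IA : \int[Pr]_w (\1_A (Y j w))%:E = Pr (Y j @^-1` A).
  rewrite (_ : (fun w => _) = (fun w => (\1_(Y j @^-1` A) w)%:E)).
    by rewrite integral_indic ?setIT//; exact: mYpre.
  by apply/funext => w; rewrite !indicE.
have := IH (S :\ j) _ f'; rewrite (bigD1 j)//= f'j IA.
under [in RHS]eq_bigr => i /andP[_ ij] do rewrite (f'E i ij).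
rewrite -CE muleC => <-.
- apply: eq_integral => w _; rewrite (bigD1 j)//= f'j mulrC; congr (_ * _)%:E.
  by apply: eq_bigr => i /andP[_ ij]; rewrite f'E.
- by move: Sk; rewrite (cardsD1 j) jS.
- move=> i; have [->|ij] := eqVneq i j; rewrite ?f'j ?f'E//.
- by move=> i; have [->|ij] := eqVneq i j; rewrite ?f'j ?f'E//.
- move=> i iD; have [->|ij] := eqVneq i j; rewrite ?f'j ?f'E// ?fy//.
  by rewrite IA (le_lt_trans (probability_le1 _ _))// ?ltry//; exact: mYpre.
- split => //; first by rewrite (fintype.subset_trans _ SD)// finset.subsetDl.
  move=> i; rewrite !inE; have [->|ij] := eqVneq i j; first by exists A.
  by move=> /= iDS; rewrite f'E//; apply: fS; rewrite inE.
Qed.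
End independence.

(** * Hoeffding's lemma for variables with values in [-1, 1] *)

(** Convexity of [expR], since [l * x] is the average of [l] and [- l] with weights [(1 + x) / 2]
    and [(1 - x) / 2]. *)
Lemma expR_le_chord (R : realType) (l x : R) : `|x| <= 1 ->
  expR (l * x) <= (1 + x) / 2 * expR l + (1 - x) / 2 * expR (- l).
Proof.
rewrite ler_norml => /andP[x1 x2].
have t0 : 0 <= (1 + x) / 2 by rewrite divr_ge0//; lra.
have t1 : (1 + x) / 2 <= 1 by rewrite ler_pdivrMr//; lra.
have := @convex_expR R (Itv01 t0 t1) l (- l).
rewrite !convRE /= /unstable.onem.
rewrite (_ : (1 + x) / 2 * l + _ * - l = l * x); last by field.
by rewrite (_ : 1 - (1 + x) / 2 = (1 - x) / 2); last by field.
Qed.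

(** The chord bound is affine in [X], so its expectation depends only on the mean [m] and coincides
    with that for the two-point law on -1 and 1 of mean [m], which [two_point_mgf_le] bounds. *)
Lemma hoeffding_mgf (R : realType) (d : measure_display) (T : measurableType d)
    (P : probability T R) (X : {mfun T >-> R}) (l : R) :
  (forall x, `|X x| <= 1) ->
  (\int[P]_x (expR (l * (X x - fine 'E_P[X])))%:E <= (expR (l ^+ 2 / 2))%:E)%E.
Proof.
move=> X1; set m := fine _.
have iX : P.-integrable setT (EFin \o X).
  apply: (@le_integrable _ _ _ P setT measurableT _ (cst 1%:E)) => //.
  - exact/measurable_EFinP.
  - by move=> x _ /=; rewrite lee_fin normr1.
  - exact: finite_measure_integrable_cst.
have Em : ('E_P[X] = m%:E)%E.
  by rewrite fineK// unlock; exact: integrable_fin_num.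
have m1 : `|m| <= 1.
  rewrite -lee_fin -abse_EFin -Em unlock.
  apply: le_trans (le_abse_integral _ _ _) _ => //; first exact: measurable_int iX.
  have <- : (\int[P]_x (cst 1%:E) x = 1)%E.
    by rewrite integral_cst// mul1e; exact: probability_setT.
  apply: ge0_le_integral => //.
  - by apply/measurableT_comp => //; exact: measurable_int iX.
  - by move=> x _ /=; rewrite lee_fin.
have := @two_point_mgf_le _ m l m1; rewrite -lee_fin; apply: le_trans.
(* [a] and [b] are the values of [expR (l * (x - m))] at 1 and -1; the chord between them is
   [(a + b) / 2 + (a - b) / 2 * x]. *)
pose a := expR (l * (1 - m)); pose b := expR (- (l * (1 + m))).
have IE (p q : R) : (\int[P]_x (p + q * X x)%:E = (p + q * m)%:E)%E.
  under eq_integral do rewrite EFinD EFinM.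
  rewrite integralD//=; last 2 first.
  - exact: finite_measure_integrable_cst.
  - exact: integrableZl.
  rewrite integral_cst// integralZl//= [P _]probability_setT mule1.
  by rewrite EFinD EFinM -Em unlock.
rewrite (_ : _ / 2 * _ + _ = (a + b) / 2 + (a - b) / 2 * m); last first.
  by rewrite -/a -/b; field.
rewrite -(IE ((a + b) / 2) ((a - b) / 2)); apply: ge0_le_integral => //.
- apply/measurable_EFinP; apply: measurableT_comp => //.
  by apply: measurable_funM => //; exact: measurable_funB.
- apply/measurable_EFinP; apply: measurable_funD => //; exact: measurable_funM.
- move=> x _; rewrite lee_fin mulrBr expRD.
  have /(ler_wpM2r (expR_ge0 (- (l * m)))) := expR_le_chord l (X1 x).
  rewrite mulrDl -!mulrA -!expRD.
  rewrite (_ : l - l * m = l * (1 - m)); last by ring.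
  rewrite (_ : - l - l * m = - (l * (1 + m))); last by ring.
  rewrite -/a -/b => /le_trans; apply.
  by rewrite le_eqVlt; apply/orP; left; apply/eqP; field.
Qed.

(** * Two-sided Chernoff bound *)

(** Chernoff's exponent [l ^+ 2 * V / 2 - l * t] is smallest at [l = t / V], where it equals
    [- (t ^+ 2 / (2 * V))]. The chosen threshold [t] makes this [- ln (2 / delta)], so each tail has
    probability at most [delta / 2]. *)
Lemma subgaussian_tail (R : realType) (d : measure_display)
    (Omega : measurableType d) (P : probability Omega R)
    (S : {mfun Omega >-> R}) (V delta : R) : 0 < V -> 0 < delta < 1 ->
  (forall l, (\int[P]_w (expR (l * S w))%:E <= (expR (l ^+ 2 * V / 2))%:E)%E) ->
  ((1 - delta)%:E <=
    P [set w | (`|S w| <= Num.sqrt (2 * V * ln (2 / delta)))%R])%E.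
Proof.
move=> V0 /andP[delta0 delta1] mgf.
set L := ln (2 / delta).
have L0 : 0 < L by rewrite ln_gt0// ltr_pdivlMr//; lra.
set t := Num.sqrt _.
have t0 : 0 < t by rewrite sqrtr_gt0 !mulr_gt0.
have t2 : t ^+ 2 = 2 * V * L by rewrite sqr_sqrtr// !mulr_ge0// ltW.
have tail (Z : {mfun Omega >-> R}) :
    (\int[P]_w (expR (t / V * Z w))%:E <= (expR ((t / V) ^+ 2 * V / 2))%:E)%E ->
    (P [set w | (t <= Z w)%R] <= (delta / 2)%:E)%E.
  move=> Zmgf; apply: le_trans (chernoff Z t (divr_gt0 t0 V0)) _.
  rewrite /mmt_gen_fun unlock.
  apply: (@le_trans _ _
      ((expR ((t / V) ^+ 2 * V / 2))%:E * (expR (- (t / V * t)))%:E)%E).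
    rewrite lee_wpmul2r ?lee_fin ?expR_ge0//; apply: le_trans Zmgf.
    rewrite le_eqVlt; apply/orP; left; apply/eqP.
    by apply: eq_integral => w _; rewrite /= mulrC.
  rewrite -EFinM lee_fin -expRD.
  rewrite (_ : _ + _ = - (t ^+ 2 / (2 * V))); last by field; rewrite gt_eqF.
  rewrite t2 (_ : _ / _ = L); last by field; rewrite gt_eqF.
  by rewrite expRN lnK ?invf_div// posrE divr_gt0.
set A := [set w | _].
pose B := [set w | t <= S w] `|` [set w | t <= (- S w)].
have mge (Z : Omega -> R) :
    measurable_fun setT Z -> measurable [set w | t <= Z w].
  by move=> mZ; rewrite -[X in measurable X]setTI; exact: measurable_fun_le.
have mS := mge S (measurable_funPT S).
have mNS := mge (- S : {mfun _ >-> _}) (measurable_funPT _).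
(* Off both closed tails the inequality is even strict, so a union bound on [B] suffices. *)
have BA : ~` B `<=` A.
  move=> w /not_orP[/negP]; rewrite -ltNge => St /negP; rewrite -ltNge => NSt.
  by rewrite /A /= ler_norml; apply/andP; split; lra.
have mB : measurable B by exact: measurableU.
have mA : measurable A.
  rewrite -[A]setTI; apply: measurable_fun_le => //.
  exact: measurableT_comp.
apply: (@le_trans _ _ (P (~` B))); last first.
  by apply: le_measure; rewrite ?inE//; exact: measurableC.
rewrite probability_setC// EFinB leeB//.
apply: le_trans (measureU2 _ _ _) _ => //.
rewrite [in leRHS](splitr delta) EFinD; apply: leeD; first exact: tail.
apply: (tail (- S : {mfun _ >-> _})).
under eq_integral do rewrite mulrN -mulNr.
by apply: le_trans (mgf _) _; rewrite sqrrN.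
Qed.

(** * Moment bound for the shots of one component *)

Lemma lee_prod (R : realDomainType) (I : Type) (r : seq I) (P : pred I)
    (f g : I -> \bar R) : (forall i, P i -> 0 <= f i <= g i)%E ->
  (\prod_(i <- r | P i) f i <= \prod_(i <- r | P i) g i)%E.
Proof.
move=> fg; suff /andP[] : (0 <= \prod_(i <- r | P i) f i <=
    \prod_(i <- r | P i) g i)%E by [].
elim/big_rec2 : _ => [|i x y Pi /andP[y0 yx]]; first by rewrite lexx lee_fin ler01.
by have /andP[f0 fgi] := fg i Pi; rewrite mule_ge0//= lee_pmul.
Qed.

(** Independence factors the expectation over the shots; Hoeffding's lemma bounds each of the [N]
    factors, and the exponents [a ^+ 2 / 2] add up. *)
Lemma hoeffding_mgf_iid (R : realType) (d d' : measure_display)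
    (Omega : measurableType d) (Pr : probability Omega R)
    (O : measurableType d') (law : probability O R) (X : {mfun O >-> R})
    (N : nat) (shot : 'I_N -> {mfun Omega >-> O}) (a : R) :
  (forall x, `|X x| <= 1) ->
  (forall k (A : set O), measurable A -> distribution Pr (shot k) A = law A) ->
  mutually_independent Pr finset.setT (fun k => shot k) ->
  (\int[Pr]_w (\prod_(k < N) expR (a * (X (shot k w) - fine 'E_law[X])))%:E
   <= (expR (N%:R * (a ^+ 2 / 2)))%:E)%E.
Proof.
move=> X1 shotE indep.
pose f (x : O) := expR (a * (X x - fine 'E_law[X])).
have mf : measurable_fun setT f.
  apply: measurableT_comp => //; apply: measurable_funM => //.
  exact: measurable_funB.
have intE k : (\int[Pr]_w (f (shot k w))%:E <= (expR (a ^+ 2 / 2))%:E)%E.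
  apply: le_trans (hoeffding_mgf law a X1).
  (* Change of variables to the outcome space, where every shot has distribution [law]. *)
  rewrite -(ge0_integral_distribution (shot k : {RV Pr >-> O})
    (f := EFin \o f))//.
  - by rewrite (eq_measure_integral law)// => A mA _; exact: shotE.
  - exact/measurable_EFinP.
  - by move=> x; rewrite lee_fin expR_ge0.
have := @integral_prod_indep _ _ _ Pr 'I_N finset.setT _ (fun=> O)
  (fun k => shot k) (fun=> f).
have inT (Rt : Type) (idx : Rt) op (F : 'I_N -> Rt) :
    \big[op/idx]_(k in finset.setT) F k = \big[op/idx]_(k < N) F k.
  by apply: eq_bigl => k; rewrite inE.
rewrite inT; under eq_integral do rewrite inT.
move=> ->//.
- apply: (@le_trans _ _ (\prod_(k < N) (expR (a ^+ 2 / 2))%:E)%E).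
    apply: lee_prod => k _; rewrite intE andbT.
    by apply: integral_ge0 => w _; rewrite lee_fin expR_ge0.
  by rewrite prodEFin lee_fin -expR_sum sumr_const card_ord mulr_natl.
- by move=> k x; exact: expR_ge0.
- by move=> k _; apply: le_lt_trans (intE k) _; rewrite ltry.
Qed.

(** * Concentration of the energy estimator *)

Unset Implicit Arguments.

Theorem proposition5
  (R : realType) (n : nat)
  (PP : {set pauli_string n}) (c : pauli_string n -> R)
  (psi : 'cV[R[i]]_#|{: bitstring n}|) (g : bitstring n -> R)
  (* circuit components: outcome spaces, outcome laws, observables *)
  (T : pauli_string n -> {set part})
  (dO : pauli_string n -> part -> measure_display)
  (Out : forall P t, measurableType (dO P t))
  (law : forall P t, probability (Out P t) R)
  (X : forall P t, {mfun Out P t >-> R})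
  (* shots, as random elements on a common probability space *)
  (N : nat) (d : measure_display) (Omega : measurableType d)
  (Pr : probability Omega R)
  (shot : forall P t, 'I_N -> {mfun Omega >-> Out P t})
  (delta : R) :
  normalized psi ->
  (forall P, P \in PP -> T P != finset.set0) ->
  (forall P t s, P \in PP -> t \in T P -> `|X P t s| <= 1) ->
  energy PP c psi g =
    \sum_(P in PP) c P * \sum_(t in T P) fine 'E_(law P t)[X P t] ->
  (0 < N)%N ->
  (forall P t k (A : set (Out P t)), P \in PP -> t \in T P -> measurable A ->
     distribution Pr (shot P t k) A = law P t A) ->
  (forall P t, P \in PP -> t \in T P ->
     mutually_independent Pr finset.setT (fun k => shot P t k)) ->
  mutually_independent Pr
    (finset.finset (fun i : pauli_string n * part => (i.1 \in PP) && (i.2 \in T i.1)))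
    (fun i w => [tuple shot i.1 i.2 k w | k < N]) ->
  0 < delta < 1 ->
  ((1 - delta)%:E <=
   Pr [set w |
     (`| \sum_(P in PP) c P *
           \sum_(t in T P) sample_mean (X P t) (fun k => shot P t k w)
         - energy PP c psi g |
      <= 2 * Num.sqrt (\sum_(P in PP) c P ^+ 2)
           * Num.sqrt (ln (2 / delta) / N%:R))%R])%E.
Proof.
move=> _ _ X1 energyE N0 shotE indep_shots indep_comp.
move=> /[dup] delta01 /andP[delta0 delta1].
pose mu P t := fine 'E_(law P t)[X P t].
pose SS w := \sum_(P in PP) c P *
  \sum_(t in T P) sample_mean (X P t) (fun k => shot P t k w) - energy PP c psi g.
pose D := finset.finset
  (fun i : pauli_string n * part => (i.1 \in PP) && (i.2 \in T i.1)).
have NR0 : 0 < N%:R :> R by rewrite ltr0n.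
(* The exact energy is spread evenly over the [N] shots, so that every term of the error is
   centered. *)
have SSE w : SS w = \sum_(i in D) \sum_(k < N)
    c i.1 / N%:R * (X i.1 i.2 (shot i.1 i.2 k w) - mu i.1 i.2).
  transitivity (\sum_(P in PP) \sum_(t in T P) \sum_(k < N)
      c P / N%:R * (X P t (shot P t k w) - mu P t)).
    rewrite /SS energyE -sumrB; apply: eq_bigr => P _.
    rewrite -mulrBr -sumrB mulr_sumr; apply: eq_bigr => t _.
    rewrite /sample_mean -mulr_sumr sumrB sumr_const card_ord -/(mu P t).
    by rewrite -[mu P t *+ N]mulr_natl; field; rewrite gt_eqF.
  by rewrite pair_big_dep /=; apply: eq_bigl => i; rewrite inE.
have mSS : measurable_fun setT SS.
  rewrite (_ : SS = fun w => \sum_(i <- enum D) \sum_(k < N)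
      c i.1 / N%:R * (X i.1 i.2 (shot i.1 i.2 k w) - mu i.1 i.2)); last first.
    by apply/funext => w; rewrite SSE big_enum.
  apply: measurable_sum => i; apply: measurable_sum => k.
  apply: measurable_funM => //; apply: measurable_funB => //.
  exact: measurableT_comp.
pose S : {mfun Omega >-> R} := mfun_Sub (mem_set mSS).
pose K := \sum_(P in PP) c P ^+ 2.
have K0 : 0 <= K by apply: sumr_ge0 => P _; exact: sqr_ge0.
rewrite -[X in Pr X]/[set w |
  `|SS w| <= 2 * Num.sqrt K * Num.sqrt (ln (2 / delta) / N%:R)].
(* [subgaussian_tail] needs a positive variance proxy; if [K = 0], all [c P] with [P] in [PP] vanish
   and the error is identically zero. *)
have [Kz|Kn0] := eqVneq K 0.
  rewrite (_ : [set w | _] = setT).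
    by rewrite probability_setT lee_fin; lra.
  apply/seteqP; split => // w _ /=.
  rewrite SSE big1 ?normr0 ?mulr_ge0 ?sqrtr_ge0// => i; rewrite inE => /andP[iPP _].
  apply: big1 => k _.
  have /eqP := psumr_eq0P (fun P _ => sqr_ge0 (c P)) Kz iPP.
  by rewrite sqrf_eq0 => /eqP ->; rewrite !mul0r.
have {Kn0}K0 : 0 < K by rewrite lt_neqAle eq_sym Kn0.
have V0 : 0 < 2 * K / N%:R by rewrite divr_gt0// mulr_gt0.
have L0 : 0 <= ln (2 / delta) by rewrite ln_ge0// ler_pdivlMr//; lra.
(* The stated radius is that of [subgaussian_tail] for the variance proxy [2 * K / N%:R], in which 2
   bounds [#|T P|]. *)
have -> : 2 * Num.sqrt K * Num.sqrt (ln (2 / delta) / N%:R) =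
    Num.sqrt (2 * (2 * K / N%:R) * ln (2 / delta)).
  rewrite (_ : _ * ln _ = 2 ^+ 2 * K * (ln (2 / delta) / N%:R)); last first.
    by field; rewrite gt_eqF.
  rewrite [RHS]sqrtrM ?mulr_ge0 ?sqr_ge0 ?(ltW K0)//; congr (_ * _).
  by rewrite sqrtrM ?sqr_ge0// sqrtr_sqr ger0_norm.
apply: (subgaussian_tail (S := S) V0 delta01) => l.
(* Independence across components concerns whole tuples of shots, so each factor is written as a
   function of the tuple [Y i]; independence within a component enters in [intY]. *)
pose f (i : pauli_string n * part) (s : N.-tuple (Out i.1 i.2)) : R :=
  \prod_(k < N) expR (l * (c i.1 / N%:R) * (X i.1 i.2 (tnth s k) - mu i.1 i.2)).
pose Y (i : pauli_string n * part) w := [tuple shot i.1 i.2 k w | k < N].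
have fY i w : f i (Y i w) = \prod_(k < N)
    expR (l * (c i.1 / N%:R) * (X i.1 i.2 (shot i.1 i.2 k w) - mu i.1 i.2)).
  by apply: eq_bigr => k _; rewrite tnth_mktuple.
have mY i : measurable_fun setT (Y i).
  apply/measurable_fun_tnthP => k.
  rewrite (_ : _ \o _ = shot i.1 i.2 k)//.
  by apply/funext => w /=; rewrite tnth_mktuple.
have mf i : measurable_fun setT (f i).
  apply: measurable_prod => k _; apply: measurableT_comp => //.
  apply: measurable_funM => //; apply: measurable_funB => //.
  by apply: measurableT_comp => //; exact: measurable_tnth.
have f_ge0 i x : 0 <= f i x by apply: prodr_ge0 => k _; exact: expR_ge0.
have intY i : i \in D -> (\int[Pr]_w (f i (Y i w))%:E <=
    (expR (N%:R * ((l * (c i.1 / N%:R)) ^+ 2 / 2)))%:E)%E.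
  rewrite inE => /andP[iPP iT]; under eq_integral do rewrite fY.
  apply: (hoeffding_mgf_iid (law := law i.1 i.2)).
  - by move=> x; exact: X1.
  - by move=> k A mA; exact: shotE.
  - exact: indep_shots.
have -> : (\int[Pr]_w (expR (l * S w))%:E =
    \int[Pr]_w (\prod_(i in D) f i (Y i w))%:E)%E.
  apply: eq_integral => w _; rewrite /S /= SSE mulr_sumr expR_sum; congr EFin.
  apply: eq_bigr => i _; rewrite fY mulr_sumr expR_sum.
  by apply: eq_bigr => k _; rewrite mulrA.
rewrite (integral_prod_indep (D := D) (Y := Y) mY mf f_ge0 _ indep_comp); last first.
  by move=> i iD; apply: le_lt_trans (intY i iD) _; rewrite ltry.
apply: (@le_trans _ _ (\prod_(i in D)
    (expR (N%:R * ((l * (c i.1 / N%:R)) ^+ 2 / 2)))%:E)%E).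
  apply: lee_prod => i iD; rewrite intY// andbT.
  by apply: integral_ge0 => w _; rewrite lee_fin.
rewrite prodEFin lee_fin -expR_sum ler_expR.
have -> : \sum_(i in D) N%:R * ((l * (c i.1 / N%:R)) ^+ 2 / 2) =
    \sum_(P in PP) \sum_(t in T P) l ^+ 2 / (2 * N%:R) * c P ^+ 2.
  rewrite pair_big_dep /=; apply: eq_big => i; first by rewrite inE.
  by move=> _; field; rewrite gt_eqF.
(* The inner sum is constant in [t] and contributes a factor [#|T P|], at most 2 because
   [bool_of_part] is injective. *)
rewrite (_ : _ / 2 = \sum_(P in PP) 2 * (l ^+ 2 / (2 * N%:R) * c P ^+ 2)).
  apply: ler_sum => P _; rewrite sumr_const -[leLHS]mulr_natl ler_wpM2r//.
    by rewrite mulr_ge0 ?sqr_ge0// divr_ge0 ?sqr_ge0.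
  rewrite ler_nat (leq_trans (max_card _))//.
  by rewrite -(card_bool); apply: (leq_card _ (can_inj bool_of_partK)).
by rewrite -mulr_sumr -mulr_sumr -/K; field; rewrite gt_eqF.
Qed.
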